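(* Let $\mathcal{C}$ be a nondegenerate $[n,k]_{q^m/q}$ code and let $w^{\mathrm{rk}}(\mathcal{C})$ be the maximum rank of a codeword of $\mathcal{C}$. Then $w^{\mathrm{rk}}(\mathcal{C})=\min\{n,m\}$. In particular, if $n=m$, then an $[n,k]_{q^n/q}$ code $\mathcal{C}$ is nondegenerate if and only if $w^{\mathrm{rk}}(\mathcal{C})=n$.
   Context: Let $q$ be a prime power and $n,m,k$ positive integers. For $v\in\mathbb{F}_{q^m}^n$ and an ordered basis $\Gamma=(\gamma_1,\dots,\gamma_m)$ of $\mathbb{F}_{q^m}$ over $\mathbb{F}_q$, let $\Gamma(v)\in\mathbb{F}_q^{n\times m}$ be the matrix with $v_i=\sum_{j=1}^m\Gamma(v)_{ij}\gamma_j$. The rank support $\sigma^{\mathrm{rk}}(v)\subseteq\mathbb{F}_q^n$ is the column space of $\Gamma(v)$ (it does not depend on $\Gamma$), and the rank of $v$ is $\mathrm{rk}(v)=\dim_{\mathbb{F}_q}\sigma^{\mathrm{rk}}(v)$. An $[n,k]_{q^m/q}$ code is a $k$-dimensional $\mathbb{F}_{q^m}$-subspace $\mathcal{C}\subseteq\mathbb{F}_{q^m}^n$; its elements are called codewords. Its rank support is $\sigma^{\mathrm{rk}}(\mathcal{C})=\sum_{v\in\mathcal{C}}\sigma^{\mathrm{rk}}(v)$, and $\mathcal{C}$ is (rank-)nondegenerate if $\sigma^{\mathrm{rk}}(\mathcal{C})=\mathbb{F}_q^n$. *)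

(* Defs.v *)
From HB Require Import structures.
From mathcomp Require Import all_boot all_order all_algebra all_field.
Set Implicit Arguments. Unset Strict Implicit. Unset Printing Implicit Defensive.
Import GRing.Theory.
Local Open Scope ring_scope.

(* F = F_q and L = F_{q^m}; the ordered basis Gamma is kept as a parameter,
   its length m is the degree [L : F] as soon as it is a basis. *)

Definition expansion_mx (F : finFieldType) (L : fieldExtType F) (n m : nat)
    (Gamma : m.-tuple L) (v : 'rV[L]_n) : 'M[F]_(n, m) :=
  \matrix_(i, j) coord Gamma j (v 0 i).

(* Columns are transposed so that both L^n and F^n consist of row vectors. *)
Definition column_space (F : fieldType) (n m : nat) (A : 'M[F]_(n, m)) :
    {vspace 'rV[F]_n} :=
  <<[seq (col j A)^T | j : 'I_m]>>%VS.

Definition rank_support (F : finFieldType) (L : fieldExtType F) (n m : nat)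
    (Gamma : m.-tuple L) (v : 'rV[L]_n) : {vspace 'rV[F]_n} :=
  column_space (expansion_mx Gamma v).

Definition rk (F : finFieldType) (L : fieldExtType F) (n m : nat)
    (Gamma : m.-tuple L) (v : 'rV[L]_n) : nat :=
  \dim (rank_support Gamma v).

(* [finvect_type L] is L itself, equipped with its finType structure; it is
   only used to make the codewords range over a finite type. *)
Definition code_rank_support (F : finFieldType) (L : fieldExtType F)
    (n m : nat) (Gamma : m.-tuple L) (C : {vspace 'rV[L]_n}) :
    {vspace 'rV[F]_n} :=
  (\sum_(v : 'rV[finvect_type L]_n | (v : 'rV[L]_n) \in C)
      rank_support Gamma (v : 'rV[L]_n))%VS.

Definition rank_nondegenerate (F : finFieldType) (L : fieldExtType F) (n m : nat)
    (Gamma : m.-tuple L) (C : {vspace 'rV[L]_n}) : Prop :=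
  code_rank_support Gamma C = fullv.

Definition max_rk (F : finFieldType) (L : fieldExtType F) (n m : nat)
    (Gamma : m.-tuple L) (C : {vspace 'rV[L]_n}) : nat :=
  \max_(v : 'rV[finvect_type L]_n | (v : 'rV[L]_n) \in C)
     rk Gamma (v : 'rV[L]_n).

Lemma expansion_mxP (F : finFieldType) (L : fieldExtType F) (n m : nat)
    (Gamma : m.-tuple L) (v : 'rV[L]_n) (i : 'I_n) :
  basis_of fullv Gamma ->
  v 0 i = \sum_(j < m) expansion_mx Gamma v i j *: Gamma`_j.
Proof.
move=> bG; rewrite {1}(coord_basis bG (memvf (v 0 i))).
by apply: eq_bigr => j _; rewrite mxE.
Qed.

Lemma rank_support_indep (F : finFieldType) (L : fieldExtType F)
    (n m m' : nat) (Gamma : m.-tuple L) (Gamma' : m'.-tuple L)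
    (v : 'rV[L]_n) :
  basis_of fullv Gamma -> basis_of fullv Gamma' ->
  rank_support Gamma v = rank_support Gamma' v.
Proof.
have sub p p' (G : p.-tuple L) (G' : p'.-tuple L) : basis_of fullv G' ->
  (rank_support G v <= rank_support G' v)%VS.
  move=> bG'; apply/span_subvP => _ /mapP [j _ ->].
  have -> : (col j (expansion_mx G v))^T =
    \sum_(l < p') coord G j G'`_l *: (col l (expansion_mx G' v))^T.
    apply/rowP => i; rewrite summxE !mxE.
    rewrite {1}(coord_basis bG' (memvf (v 0 i))) linear_sum /=.
    by apply: eq_bigr => l _; rewrite linearZ !mxE /= mulrC.
  apply: memv_suml => l _; apply/memvZ/memv_span/mapP.
  by exists l; rewrite ?mem_enum.
by move=> bG bG'; apply/eqP; rewrite eqEsubv !sub.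
Qed.

(* Main.v *)
(** For nonzero [a] in F^n put [a^perp := {v | \sum_i a_i v_i = 0}], an L-subspace
    of L^n. A codeword [v] has rank at least [r := min n m] as soon as it avoids
    [a^perp] for every nonzero [a] supported on the first [r] coordinates, since
    then [v_1, ..., v_r] are independent over F. If [C] is nondegenerate, each
    [a^perp] meets [C] in a proper subspace, i.e. in at most [|C| / |L|] vectors,
    and there are only [q^r - 1 < q^m = |L|] such [a], so these subspaces do not
    cover [C]. *)

Require Import Defs.
From mathcomp Require Import all_boot all_order all_algebra all_field.

Set Implicit Arguments.
Unset Strict Implicit.

Import GRing.Theory.
Local Open Scope ring_scope.

Lemma card_finvect_vspace (K : finFieldType) (vT : vectType K)
    (U : {vspace vT}) :
  #|[pred v : finvect_type vT | v \in U]| = (#|K| ^ \dim U)%N.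
Proof.
case: vT U => T cT U.
pose fT : finType := finvect_type (Vector.Pack cT).
exact: (@card_vspace K fT cT U).
Qed.

Lemma vspace_avoid (K : finFieldType) (vT : vectType K) (C : {vspace vT})
    (I : finType) (P : pred I) (W : I -> {vspace vT}) :
  (#|P| < #|K|)%N -> (forall i, P i -> ~~ (C <= W i)%VS) ->
  exists2 v, v \in C & forall i, P i -> v \notin W i.
Proof.
move=> ltPK nCW; pose fT : finType := finvect_type vT.
have card_vs (U : {vspace vT}) : #|[set v : fT | v \in U]| = (#|K| ^ \dim U)%N.
  by rewrite cardsE card_finvect_vspace.
have [/existsP[v /andP[Cv /forallP nWv]] | /existsPn coverC] :=
  boolP [exists v : fT, (v \in C) && [forall i, P i ==> (v \notin W i)]].
  by exists v => // i; apply/implyP.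
have subC : [set v : fT | v \in C] \subset
    \bigcup_(i | P i) [set v : fT | v \in (C :&: W i)%VS].
  apply/subsetP => v; rewrite inE => Cv.
  have := coverC v; rewrite Cv /= => /forallPn[i].
  rewrite negb_imply negbK => /andP[Pi Wv].
  by apply/bigcupP; exists i => //; rewrite inE (@memv_cap K vT) Cv.
have K_gt1 : (1 < #|K|)%N := finNzRing_gt1 K.
(* If the [C :&: W i] covered [C], a union bound would give this. Both sides carry a factor [#|K|],
   so that the size of a proper subspace is bounded without division. *)
suff : (#|K| * #|K| ^ \dim C <= #|P| * #|K| ^ \dim C)%N.
  by rewrite leq_pmul2r ?expn_gt0 ?(ltnW K_gt1) // leqNgt ltPK.
apply: (@leq_trans (\sum_(i | P i) #|K| * #|K| ^ \dim (C :&: W i))).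
  rewrite -big_distrr leq_mul2l -card_vs; apply/orP; right.
  apply: leq_trans (subset_leq_card subC) _.
  apply: (big_ind2 (fun (A : {set fT}) k => #|A| <= k)%N).
  - by rewrite cards0.
  - move=> A1 k1 A2 k2 le1 le2.
    by apply: leq_trans (leq_card_setU _ _) (leq_add le1 le2).
  - by move=> i _; rewrite card_vs.
rewrite -sum_nat_const leq_sum // => i Pi.
rewrite -expnS (leq_exp2l _ _ K_gt1) ltn_neqAle dimvS ?capvSl // andbT.
apply: contra (nCW i Pi) => /eqP eq_dim; apply/capv_idPl/eqP.
by rewrite eqEdim capvSl eq_dim leqnn.
Qed.

(** Writing each column in a basis of the column space factors [A] through dimension
    [\dim (column_space A)]. *)
Lemma rank_le_dim_column_space (F : fieldType) (n m : nat) (A : 'M[F]_(n, m)) :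
  (\rank A <= \dim (column_space A))%N.
Proof.
set U := column_space A; pose b := vbasis U.
have -> : A = (\matrix_(l < \dim U) b`_l)^T *m
              (\matrix_(j, l) coord b l (col j A)^T)^T.
  apply/matrixP => i j.
  have Uj : (col j A)^T \in U.
    by apply/memv_span/mapP; exists j; rewrite ?mem_enum.
  have /rowP/(_ i) := coord_vbasis Uj; rewrite !mxE summxE => ->.
  by apply: eq_bigr => l _; rewrite !mxE mulrC.
exact: mulmx_max_rank.
Qed.

Section Rank.

Context {F : finFieldType} {L : fieldExtType F} {n m : nat}.
Variable Gamma : m.-tuple L.
Implicit Type C : {vspace 'rV[L]_n}.

Lemma rk_le_minn (v : 'rV[L]_n) : (rk Gamma v <= minn n m)%N.
Proof.
rewrite leq_min; apply/andP; split.
  by apply: leq_trans (dimvS (subvf _)) _; rewrite dimvf /dim /= mul1n.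
by apply: leq_trans (dim_span _) _; rewrite size_map -cardE card_ord.
Qed.

(** This is [a^perp]; the entries of [a] are moved into [L] so that the kernel is an
    [L]-subspace. *)
Definition annihilator (a : 'rV[F]_n) : {vspace 'rV[L]_n} :=
  lker (linfun (mulmxr (map_mx (in_alg L) a)^T : _ -> 'rV[L]_1)).

Lemma memv_annihilator a v :
  (v \in annihilator a) = (\sum_i a 0 i *: v 0 i == 0).
Proof.
have pairing : (v *m (map_mx (in_alg L) a)^T) 0 0 = \sum_i a 0 i *: v 0 i.
  by rewrite mxE; apply: eq_bigr => i _; rewrite !mxE mulrC -mulr_algl.
rewrite memv_ker lfunE /= -pairing; apply/eqP/eqP => [-> | v0].
  by rewrite mxE.
by apply/rowP => z; rewrite ord1 v0 mxE.
Qed.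

Hypothesis Gamma_basis : basis_of fullv Gamma.

(** The entries of [a *m expansion_mx Gamma v] are the coordinates of [\sum_i a_i v_i] in the basis
    [Gamma]. *)
Lemma annihilatorP (a : 'rV[F]_n) (v : 'rV[L]_n) :
  reflect (a *m expansion_mx Gamma v = 0) (v \in annihilator a).
Proof.
have -> : (v \in annihilator a) =
    (\sum_j (a *m expansion_mx Gamma v) 0 j *: Gamma`_j == 0).
  rewrite memv_annihilator; congr (_ == 0).
  under eq_bigr do rewrite (expansion_mxP v _ Gamma_basis) scaler_sumr.
  rewrite exchange_big /=; apply: eq_bigr => j _.
  by rewrite mxE scaler_suml; apply: eq_bigr => i _; rewrite scalerA.
apply: (iffP eqP) => [/(elimT freeP (basis_free Gamma_basis)) aM | ->].
  by apply/rowP => j; rewrite aM mxE.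
by rewrite big1 // => j _; rewrite mxE scale0r.
Qed.

(** A row vector [a] killing [E *m expansion_mx Gamma v] puts [v] in the annihilator of [a *m E], so
    this product has independent rows. *)
Lemma rk_ge r (E : 'M[F]_(r, n)) (v : 'rV[L]_n) :
  (forall a, a != 0 -> v \notin annihilator (a *m E)) -> (r <= rk Gamma v)%N.
Proof.
move=> v_indep; apply: leq_trans (rank_le_dim_column_space _).
suff /eqP <- : row_free (E *m expansion_mx Gamma v) by apply: mxrankM_maxr.
apply: inj_row_free => a; rewrite mulmxA => /annihilatorP a0.
by apply/eqP; apply: contraTT a0 => /v_indep.
Qed.

(** If [C] lies in [a^perp], then [a] is orthogonal to every column of every expansion of a
    codeword, hence to the whole rank support, which is [F^n]. *)
Lemma rank_nondegenerate_not_sub C (a : 'rV[F]_n) :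
  rank_nondegenerate Gamma C -> a != 0 -> ~~ (C <= annihilator a)%VS.
Proof.
move=> ndC; apply: contraNN => /subvP Ca.
have sub_ker : (fullv <= lker (linfun (mulmxr a^T : _ -> 'rV[F]_1)))%VS.
  rewrite -ndC; apply/subv_sumP => v Cv; apply/span_subvP => _ /mapP[j _ ->].
  have /annihilatorP/rowP/(_ j) := Ca v Cv; rewrite mxE mxE => aj.
  rewrite memv_ker lfunE /=; apply/eqP/rowP => z; rewrite ord1 [RHS]mxE -aj mxE.
  by apply: eq_bigr => i _; rewrite !mxE mulrC.
apply/eqP/rowP => i.
(* Pairing with the unit vectors reads off the entries of [a]. *)
have := subvP sub_ker (delta_mx 0 i) (memvf _); rewrite memv_ker lfunE /=.
by rewrite -rowE => /eqP/rowP/(_ 0); rewrite !mxE.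
Qed.

Lemma rank_nondegenerate_full_rk C (v : 'rV[L]_n) :
  v \in C -> rk Gamma v = n -> rank_nondegenerate Gamma C.
Proof.
move=> Cv rk_v; apply/eqP; rewrite eqEdim subvf dimvf /dim /= mul1n -{1}rk_v.
exact/dimvS/(@sumv_sup _ _ _ (v : 'rV[finvect_type L]_n)).
Qed.

Lemma card_finvect_field : #|{: finvect_type L}| = (#|F| ^ m)%N.
Proof.
have := card_finvect_vspace (@fullv F L).
rewrite -(size_basis Gamma_basis) => <-; apply: eq_card => x.
by rewrite !inE memvf.
Qed.

Lemma exists_rk_minn C :
  rank_nondegenerate Gamma C -> exists2 v, v \in C & rk Gamma v = minn n m.
Proof.
(* [E] embeds [F^r] into [F^n] as the first [r] coordinates. *)
move=> ndC; set r := minn n m; pose E : 'M[F]_(r, n) := pid_mx r.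
have E_free : row_free E by rewrite /row_free rank_pid_mx ?geq_minl.
have few : (#|[pred a : 'rV[F]_r | a != 0%R]| < #|{: finvect_type L}|)%N.
  rewrite card_finvect_field; apply: (@leq_trans (#|F| ^ r)%N).
    (* Removing the zero vector makes the bound strict, which matters when [r = m]. *)
    rewrite -[r in (_ ^ r)%N]mul1n -card_mx [X in (_ < X)%N](cardD1 0) inE add1n.
    by apply/subset_leq_card/subsetP => a; rewrite !inE andbT.
  by rewrite leq_exp2l ?geq_minr // finNzRing_gt1.
(* The avoidance lemma is applied over the large field [L], of size [q^m]. *)
have [a nz_a | v Cv vE] := @vspace_avoid (finvect_type L) 'rV_n
    C _ _ (fun a => annihilator (a *m E)) few.
  apply: rank_nondegenerate_not_sub ndC _; apply: contraNneq nz_a => aE0.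
  by apply/eqP/(row_free_inj E_free); rewrite aE0 mul0mx.
exists v => //; apply/eqP; rewrite eqn_leq rk_le_minn; exact: rk_ge vE.
Qed.

Lemma max_rk_attained C :
  exists2 v, v \in C & rk Gamma v = max_rk Gamma C.
Proof.
pose P := [pred v : 'rV[finvect_type L]_n | (v : 'rV[L]_n) \in C].
have [|v Cv max_v] := @eq_bigmax_cond _ P (rk Gamma).
  (* The zero codeword makes the maximum range over a nonempty set. *)
  by apply/card_gt0P; exists 0; rewrite inE mem0v.
by exists v.
Qed.

Lemma rk_le_max_rk C (v : 'rV[L]_n) :
  v \in C -> (rk Gamma v <= max_rk Gamma C)%N.
Proof.
exact: (@leq_bigmax_cond _ (fun v : 'rV[finvect_type L]_n => v \in C) (rk Gamma)).
Qed.

End Rank.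

Theorem proposition3p11 (F : finFieldType) (L : fieldExtType F)
    (n m k : nat) (hn : (0 < n)%N) (hm : (0 < m)%N) (hk : (0 < k)%N)
    (Gamma : m.-tuple L) (hGamma : basis_of fullv Gamma)
    (C : {vspace 'rV[L]_n}) (hC : \dim C = k) :
  (rank_nondegenerate Gamma C -> max_rk Gamma C = minn n m) /\
  (n = m -> (rank_nondegenerate Gamma C <-> max_rk Gamma C = n)).
Proof.
have [v Cv max_v] := max_rk_attained Gamma C.
have max_rkE : rank_nondegenerate Gamma C -> max_rk Gamma C = minn n m.
  case/(exists_rk_minn hGamma) => w Cw rk_w; apply/eqP.
  by rewrite eqn_leq -{1}max_v rk_le_minn -rk_w rk_le_max_rk.
split=> // eq_nm; split=> [/max_rkE-> | max_n]; first by rewrite -eq_nm minnn.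
(* A codeword attaining the maximum [n] already has all of [F^n] as its support. *)
by apply: rank_nondegenerate_full_rk Cv _; rewrite max_v.
Qed.
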